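(* Let $\mathbb F$ be a field, $q\in\mathbb F$ with $q\neq0$, and $f,g\in\mathbb F[h]$ with $\deg f>1$ and $g\neq 0$. Let $A=\mathcal H_q(f,g)$. Then $\mathrm{Aut}(A)$ is the internal direct product $$\mathrm{Aut}(A)=\{\phi_\lambda:\lambda\in\mathbb F^*\}\ \dot\times\ \{\phi\in\mathrm{Aut}(A):\phi(x)=x\},$$ and $\{\phi_\lambda:\lambda\in\mathbb F^*\}\cong\mathbb F^*$ is central in $\mathrm{Aut}(A)$. Moreover, if either $\mathrm{char}\,\mathbb F=0$ or $\mathrm{char}\,\mathbb F>\deg f$, then $\{\phi\in\mathrm{Aut}(A):\phi(x)=x\}$ is a finite cyclic group whose order divides $\deg f-1$, and hence $\mathrm{Aut}(A)$ is abelian.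
   Context: $\mathcal H_q(f,g)$ denotes the unital associative $\mathbb F$-algebra generated by $x,y,h$ with relations $hx=xf(h)$, $yh=f(h)y$, $yx-qxy=g(h)$. For $\lambda\in\mathbb F^*$, $\phi_\lambda$ denotes the automorphism with $\phi_\lambda(x)=\lambda x$, $\phi_\lambda(y)=\lambda^{-1}y$, $\phi_\lambda(h)=h$. *)

(* Defs.v *)
From HB Require Import structures.
From mathcomp Require Import all_boot all_order all_algebra.
Set Implicit Arguments. Unset Strict Implicit. Unset Printing Implicit Defensive.
Import Order.TTheory GRing.Theory Num.Theory.
Local Open Scope ring_scope.

Definition peval (F : fieldType) (A : algType F) (p : {poly F}) (a : A) : A :=
  \sum_(i < size p) p`_i *: a ^+ i.

Definition Hrel (F : fieldType) (A : algType F) (q : F) (f g : {poly F})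
  (x y h : A) : Prop :=
  [/\ h * x = x * peval f h, y * h = peval f h * y
    & y * x - q *: (x * y) = peval g h].

Definition alg_hom (F : fieldType) (A B : algType F) (phi : A -> B) : Prop :=
  [/\ forall (a : F) (u v : A), phi (a *: u + v) = a *: phi u + phi v,
      phi 1 = 1
    & forall u v : A, phi (u * v) = phi u * phi v].

(* (A, x, y, h) is the algebra H_q(f,g) = F<x,y,h | relations>, characterized
   by its universal property: x, y, h satisfy the relations, and for every
   F-algebra B and elements a b c of B satisfying the relations there is a
   unique algebra homomorphism A -> B sending x,y,h to a,b,c. *)
Definition is_Hq (F : fieldType) (q : F) (f g : {poly F}) (A : algType F)
  (x y h : A) : Prop :=
  Hrel q f g x y h /\
  forall (B : algType F) (a b c : B), Hrel q f g a b c ->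
    (exists phi : A -> B, alg_hom phi /\ [/\ phi x = a, phi y = b & phi h = c]) /\
    (forall phi1 phi2 : A -> B, alg_hom phi1 -> alg_hom phi2 ->
       phi1 x = phi2 x -> phi1 y = phi2 y -> phi1 h = phi2 h -> phi1 =1 phi2).

Definition is_aut (F : fieldType) (A : algType F) (s : A -> A) : Prop :=
  alg_hom s /\ bijective s.

Definition is_phi (F : fieldType) (A : algType F) (x y h : A) (l : F)
  (s : A -> A) : Prop :=
  [/\ l != 0, is_aut s & [/\ s x = l *: x, s y = l^-1 *: y & s h = h]].

Definition fixes_x (F : fieldType) (A : algType F) (x : A) (s : A -> A) : Prop :=
  is_aut s /\ s x = x.

(* Main.v *)
Require Import Defs.
From HB Require Import structures.
From mathcomp Require Import all_boot all_order all_algebra.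
From mathcomp Require Import cyclic boolp functions.
From mathcomp Require Import zify.
Set Warnings "-notation-overridden,-ambiguous-paths".
Set Warnings "-redundant-canonical-projection,-projection-no-head-constant".
Import Order.TTheory GRing.Theory Num.Theory.
Local Open Scope ring_scope.

(* The operators by which x, y, h act on a basis x^i h^j y^k satisfy the
   defining relations, so the universal property makes the monomials linearly
   independent in A; they span because A is generated by x, y, h.  Comparing
   exponents of y, then of x, gives a degree that is additive on products.
   For an automorphism s, the relation s(h) s(x) = s(x) f(s(h)) and deg f > 1
   force s(h) to have degree 0, so s(h) = p(h) with deg p = 1.  Comparing the
   coefficients of that relation, every monomial x^i _ y^k of s(x) has
   i = k + 1, so s(x) = x z; doing the same for the inverse of s shows that z
   is a unit, hence a scalar.  Likewise s(y) is a multiple of y.  What is left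
   are affine polynomials p commuting with f under composition: the leading
   coefficient is a root of unity of order dividing deg f - 1, and under the
   characteristic hypothesis it determines p. *)

(** * Infinite-dimensional endomorphism algebra *)

Section Endomorphisms.
Context {F : fieldType}.
Local Notation V := (nat -> nat -> {poly F}).

(** Families in [V] carry no finite-support condition, so the operators need no support bookkeeping.
    Linearity is made boolean so that [endo] can be a subtype. *)
Definition is_endo : {pred V -> V} := fun u => `[< linear u >].

Lemma is_endo_submod_closed : submod_closed is_endo.
Proof.
split=> [|a u v /asboolP lu /asboolP lv]; apply/asboolP => b s t.
  by rewrite scaler0 addr0.
rewrite -[LHS]/(a *: u (b *: s + t) + v (b *: s + t)).
rewrite -[RHS]/(b *: (a *: u s + v s) + (a *: u t + v t)).
rewrite lu lv !scalerDr !scalerA (mulrC a b) -!addrA; congr (_ + _).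
by rewrite addrCA.
Qed.

HB.instance Definition _ :=
  GRing.isSubmodClosed.Build F (V -> V) is_endo is_endo_submod_closed.

Record endo := Endo { endo_fun :> V -> V; _ : is_endo endo_fun }.
HB.instance Definition _ := [isSub for endo_fun].
HB.instance Definition _ := [Choice of endo by <:].
HB.instance Definition _ := [SubChoice_isSubLmodule of endo by <:].

Lemma endo_linear (u : endo) : linear u.
Proof. by apply/asboolP; case: u. Qed.

Lemma endoP (u v : endo) : u =1 v -> u = v.
Proof. by move=> uv; apply: val_inj; apply: funext. Qed.

Lemma endo_subproof1 : is_endo id. Proof. exact/asboolP. Qed.
Lemma endo_subproofM (u v : endo) : is_endo (u \o v).
Proof. by apply/asboolP=> a s t /=; rewrite !endo_linear. Qed.

Definition endo1 := @Endo id endo_subproof1.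
Definition endo_mul (u v : endo) := @Endo (u \o v) (endo_subproofM u v).

Lemma endo_mulA : associative endo_mul. Proof. by move=> u v w; apply: endoP. Qed.
Lemma endo_mul1l : left_id endo1 endo_mul. Proof. by move=> u; apply: endoP. Qed.
Lemma endo_mul1r : right_id endo1 endo_mul. Proof. by move=> u; apply: endoP. Qed.
Lemma endo_mulDl : left_distributive endo_mul +%R.
Proof. by move=> u v w; apply: endoP. Qed.
Lemma endo_mulDr : right_distributive endo_mul +%R.
Proof.
move=> u v w; apply: endoP => s.
rewrite -[LHS]/(u (v s + w s)) -[RHS]/(u (v s) + u (w s)).
by rewrite -{1}[v s]scale1r endo_linear scale1r.
Qed.
Lemma endo1_neq0 : endo1 != 0.
Proof.
apply/eqP => /(congr1 (fun u : endo => u (fun _ _ => 1) 0 0)) /eqP.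
by rewrite -[X in X == _]/(1 : {poly F}) oner_eq0.
Qed.

HB.instance Definition _ := GRing.Zmodule_isNzRing.Build endo
  endo_mulA endo_mul1l endo_mul1r
  endo_mulDl endo_mulDr endo1_neq0.

Lemma endo_scalerAl (a : F) (u v : endo) : a *: (u * v) = (a *: u) * v.
Proof. exact: endoP. Qed.
HB.instance Definition _ := GRing.Lmodule_isLalgebra.Build F endo endo_scalerAl.

Lemma endo_scalerAr (a : F) (u v : endo) : a *: (u * v) = u * (a *: v).
Proof.
apply: endoP => s; rewrite -[LHS]/(a *: u (v s)) -[RHS]/(u (a *: v s)).
have u0 : u 0 = 0.
  have /eqP := endo_linear u 1 0 0.
  by rewrite !scale1r addr0 -subr_eq0 opprD addNKr oppr_eq0 => /eqP.
by rewrite -[a *: v s]addr0 endo_linear u0 !addr0.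
Qed.
HB.instance Definition _ := GRing.Lalgebra_isAlgebra.Build F endo endo_scalerAr.
End Endomorphisms.
Arguments endo : clear implicits.

(** * Generated subalgebras *)

Section Generation.
Context {F : fieldType} {A : algType F} (S : A -> Prop).

Inductive generated : A -> Prop :=
| gen_base a of S a : generated a
| gen_one : generated 1
| gen_lin c a b of generated a & generated b : generated (c *: a + b)
| gen_mul a b of generated a & generated b : generated (a * b).

Definition generatedb : {pred A} := fun a => `[< generated a >].

Lemma generated_subalg : subalg_closed generatedb.
Proof.
split=> [|c a b|a b]; first by apply/asboolP; exact: gen_one.
  by move=> /asboolP ga /asboolP gb; apply/asboolP; exact: gen_lin.
by move=> /asboolP ga /asboolP gb; apply/asboolP; exact: gen_mul.
Qed.
HB.instance Definition _ := GRing.isSubalgClosed.Build F A generatedb generated_subalg.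

Record genalg := GenAlg { genalg_val :> A; _ : generatedb genalg_val }.
HB.instance Definition _ := [isSub for genalg_val].
HB.instance Definition _ := [Choice of genalg by <:].
HB.instance Definition _ := [SubChoice_isSubAlgebra of genalg by <:].
End Generation.
Arguments genalg {F A} S.

(** * Evaluation of polynomials in an algebra *)

Section Peval.
Context {F : fieldType} {A : algType F}.
Implicit Types (p r : {poly F}) (a : A).

Lemma pevalE p a : peval p a = horner_alg a p.
Proof.
rewrite /horner_alg /horner_morph /= /map_poly horner_poly.
by apply: eq_bigr => i _; rewrite /= mulr_algl.
Qed.

Lemma pevalX a : peval 'X a = a.
Proof. by rewrite pevalE horner_algX. Qed.

Lemma pevalC c a : peval c%:P a = c%:A.
Proof. by rewrite pevalE horner_algC. Qed.

Lemma pevalD p r a : peval (p + r) a = peval p a + peval r a.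
Proof. by rewrite !pevalE rmorphD. Qed.

Lemma pevalM p r a : peval (p * r) a = peval p a * peval r a.
Proof. by rewrite !pevalE rmorphM. Qed.

Lemma pevalZ c p a : peval (c *: p) a = c *: peval p a.
Proof. by rewrite -mul_polyC pevalM pevalC mulr_algl. Qed.

Lemma pevalMXaddC p c a : peval (p * 'X + c%:P) a = peval p a * a + c%:A.
Proof. by rewrite pevalD pevalM pevalX pevalC. Qed.

Lemma peval_comp p r a : peval (p \Po r) a = peval p (peval r a).
Proof.
elim/poly_ind: p => [|p c IHp]; first by rewrite comp_poly0 !pevalE !rmorph0.
by rewrite comp_poly_MXaddC pevalD pevalM IHp pevalC pevalMXaddC.
Qed.

Lemma peval0 a : peval 0 a = 0.
Proof. by rewrite pevalE rmorph0. Qed.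

Lemma peval_intertwine p a b u : a * u = u * b -> peval p a * u = u * peval p b.
Proof.
move=> aub; elim/poly_ind: p => [|p c IHp].
  by rewrite !peval0 mul0r mulr0.
rewrite !pevalMXaddC mulrDl mulrDr -mulrA aub !mulrA IHp.
by rewrite mulr_algl mulr_algr.
Qed.
End Peval.

(** * Algebra homomorphisms *)

Section AlgHom.
Context {F : fieldType} {A B : algType F} {phi : A -> B} (hphi : alg_hom phi).

Lemma alg_hom1 : phi 1 = 1. Proof. by case: hphi. Qed.
Lemma alg_homM a b : phi (a * b) = phi a * phi b. Proof. by case: hphi. Qed.
Lemma alg_homD a b : phi (a + b) = phi a + phi b.
Proof. by case: hphi => lin _ _; rewrite -{1}[a]scale1r lin scale1r. Qed.
Lemma alg_hom0 : phi 0 = 0.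
Proof. by apply: (addrI (phi 0)); rewrite -alg_homD !addr0. Qed.
Lemma alg_homZ c a : phi (c *: a) = c *: phi a.
Proof. by case: hphi => lin _ _; rewrite -[c *: a]addr0 lin alg_hom0 addr0. Qed.
Lemma alg_homB a b : phi (a - b) = phi a - phi b.
Proof. by rewrite -scaleN1r alg_homD alg_homZ scaleN1r. Qed.
Lemma alg_hom_peval p a : phi (peval p a) = peval p (phi a).
Proof.
elim/poly_ind: p => [|p c IHp]; first by rewrite !peval0 alg_hom0.
by rewrite !pevalMXaddC alg_homD alg_homM IHp alg_homZ alg_hom1.
Qed.
Lemma alg_hom_Hrel q f g x y h :
  Hrel q f g x y h -> Hrel q f g (phi x) (phi y) (phi h).
Proof.
case=> hx yh yx; split; rewrite -?alg_hom_peval -?alg_homM ?hx ?yh //.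
by rewrite -alg_homZ -alg_homB yx.
Qed.
End AlgHom.

Lemma alg_hom_id (F : fieldType) (A : algType F) : alg_hom (@id A).
Proof. by []. Qed.

Lemma alg_hom_comp (F : fieldType) (A B C : algType F) (u : B -> C) (v : A -> B) :
  alg_hom u -> alg_hom v -> alg_hom (u \o v).
Proof.
move=> hu hv; split=> [a s t||s t] /=.
- by rewrite (alg_homD hv) (alg_homZ hv) (alg_homD hu) (alg_homZ hu).
- by rewrite (alg_hom1 hv) (alg_hom1 hu).
- by rewrite (alg_homM hv) (alg_homM hu).
Qed.

(** The generated subalgebra inherits the relations, so the universal property yields [phi] from [A]
    into it. Followed by the inclusion, [phi] fixes [x], [y] and [h], hence is the identity by
    uniqueness. *)
Lemma Hq_generated (F : fieldType) (q : F) (f g : {poly F}) (A : algType F)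
    (x y h : A) : is_Hq q f g x y h ->
  forall a, generated (fun b => b \in [:: x; y; h]) a.
Proof.
set S := fun b : A => _; move=> [rel univ] a.
have SP b (Sb : S b) : generatedb S b by apply/asboolP; exact: gen_base.
have Sx : S x by rewrite /S inE eqxx.
have Sy : S y by rewrite /S !inE eqxx orbT.
have Sh : S h by rewrite /S !inE eqxx !orbT.
pose incl (b : genalg S) : A := b.
have homi : alg_hom incl by split.
pose X : genalg S := GenAlg S x (SP _ Sx).
pose Y : genalg S := GenAlg S y (SP _ Sy).
pose Z : genalg S := GenAlg S h (SP _ Sh).
have relS : Hrel q f g X Y Z.
  case: rel => hx yh yx.
  have incl_inj : injective incl by exact: val_inj.
  split; apply: incl_inj.
  - by rewrite !(alg_homM homi) (alg_hom_peval homi).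
  - by rewrite !(alg_homM homi) (alg_hom_peval homi).
  - rewrite (alg_homB homi) (alg_homZ homi) !(alg_homM homi).
    by rewrite (alg_hom_peval homi).
have [[phi [hphi [phx phy phh]]] _] := univ _ _ _ _ relS.
have [_ uniq] := univ _ _ _ _ rel.
have -> : a = incl (phi a).
  apply: (uniq id (incl \o phi)) => //=; first exact: alg_hom_comp.
  - by rewrite phx.
  - by rewrite phy.
  - by rewrite phh.
by case: (phi a) => b /= /asboolP.
Qed.

(** * The basis representation *)

Section Representation.
Context {F : fieldType} (q : F) (f g : {poly F}).
Local Notation V := (nat -> nat -> {poly F}).

(** The compositional iterates of [f] are what moving [h] across [x ^+ n] or [y ^+ n] produces. *)
Definition fcomp (n : nat) : {poly F} := iter n (fun p => f \Po p) 'X.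

Lemma fcompSr n : fcomp n.+1 = fcomp n \Po f.
Proof.
elim: n => [|n IHn]; first by rewrite /fcomp /= comp_polyX comp_polyXr.
rewrite -[LHS]/(f \Po fcomp n.+1) IHn.
by rewrite comp_polyA -[in RHS]IHn.
Qed.

(* [y x^n = q^n x^n y + x^(n-1) gsum n (h)] *)
Fixpoint gsum (n : nat) : {poly F} :=
  if n is n'.+1 then g \Po fcomp n' + q *: gsum n' else 0.

(* Left multiplication by x, h, y, where [v i k] is the coefficient, a
   polynomial in h, standing between [x^i] and [y^k]. *)
Definition opx (v : V) : V := fun i k => if i is i'.+1 then v i' k else 0.
Definition oph (v : V) : V := fun i k => fcomp i * v i k.
Definition opy (v : V) : V := fun i k =>
  (if k is k'.+1 then q ^+ i *: (v i k' \Po f) else 0) + gsum i.+1 * v i.+1 k.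

Lemma coefsP (u v : V) : (forall i k, u i k = v i k) -> u = v.
Proof. by move=> uv; apply/funext => i; apply/funext => k. Qed.

Lemma opx_endo : is_endo opx.
Proof.
apply/asboolP => a u v; apply: coefsP => -[|i] k //.
by rewrite -[RHS]/(a *: (0 : {poly F}) + 0) scaler0 addr0.
Qed.

Lemma oph_endo : is_endo oph.
Proof.
apply/asboolP => a u v; apply: coefsP => i k.
rewrite -[LHS]/(fcomp i * (a *: u i k + v i k)).
by rewrite -[RHS]/(a *: (fcomp i * u i k) + fcomp i * v i k) mulrDr -scalerAr.
Qed.

Lemma opy_endo : is_endo opy.
Proof.
apply/asboolP => a u v; apply: coefsP => i k.
rewrite -[RHS]/(a *: opy u i k + opy v i k) /opy.
have -> : (a *: u + v) i.+1 k = a *: u i.+1 k + v i.+1 k by [].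
rewrite scalerDr mulrDr -scalerAr addrACA; congr (_ + _).
case: k => [|k]; first by rewrite scaler0 addr0.
have -> : (a *: u + v) i k = a *: u i k + v i k by [].
by rewrite comp_polyD comp_polyZ scalerDr !scalerA mulrC.
Qed.

Definition endo_x : endo F := Endo opx opx_endo.
Definition endo_h : endo F := Endo oph oph_endo.
Definition endo_y : endo F := Endo opy opy_endo.

Lemma peval_endo_h p (v : V) i k :
  (peval p endo_h : endo F) v i k = (p \Po fcomp i) * v i k.
Proof.
elim/poly_ind: p v => [|p c IHp] v; first by rewrite peval0 comp_poly0 mul0r.
rewrite pevalMXaddC comp_poly_MXaddC.
rewrite -[LHS]/((peval p endo_h : endo F) (oph v) i k + c *: v i k).
by rewrite IHp /oph mulrDl mulrA mul_polyC.
Qed.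

Lemma endo_Hrel : Hrel q f g endo_x endo_y endo_h.
Proof.
split; apply: endoP => v; apply: coefsP => i k.
- rewrite -[LHS]/(fcomp i * opx v i k).
  case: i => [|i]; rewrite /= ?mulr0 //.
  by rewrite -[RHS]/((peval f endo_h : endo F) v i k) peval_endo_h.
- rewrite -[LHS]/(opy (oph v) i k).
  rewrite -[RHS]/((peval f endo_h : endo F) (opy v) i k) peval_endo_h /opy /oph.
  rewrite mulrDr; congr (_ + _); last by rewrite mulrCA.
  case: k => [|k]; first by rewrite mulr0.
  by rewrite comp_polyM -fcompSr -scalerAr.
- rewrite -[LHS]/(opy (opx v) i k - q *: opx (opy v) i k) peval_endo_h /opy.
  rewrite [opx v i.+1 k]/=.
  case: i => [|i].
    rewrite [opx _ _ _]/= scaler0 subr0 /= !scaler0 addr0.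
    by case: k => [|k]; rewrite ?comp_poly0 ?scaler0 add0r.
  have opxS w j : opx w j.+1 k = w j k by [].
  rewrite opxS {opxS}; cbv beta.
  have -> : gsum i.+2 = g \Po fcomp i.+1 + q *: gsum i.+1 by [].
  move: (gsum i.+1) (g \Po fcomp i.+1) => G P.
  (* The two terms shifting the exponent of [y] cancel, [q ^+ i.+1] against [q * q ^+ i]; what
     remains is the recursion defining [gsum]. *)
  rewrite /= scalerDr opprD addrACA -[RHS]add0r; congr (_ + _).
    by case: k => [|k]; rewrite ?scaler0 ?subr0 // scalerA exprS subrr.
  by rewrite mulrDl -scalerAl addrK.
Qed.
End Representation.

(** * Coefficients and degrees *)

Section Coefficients.
Context {F : fieldType} {q : F} {f g : {poly F}} {A : algType F} {x y h : A}.
Context (hA : is_Hq q f g x y h).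
Local Notation V := (nat -> nat -> {poly F}).
Local Notation fcomp := (fcomp f).

(* [c a i k] is the coefficient of [a] at [x^i _ y^k]. *)
Definition coefficients (c : A -> V) : Prop :=
  [/\ forall a u v i k, c (a *: u + v) i k = a *: c u i k + c v i k,
      forall i k, c 1 i k = ((i == 0) && (k == 0))%:R,
      forall u, c (x * u) = opx (c u),
      forall u, c (y * u) = opy q f g (c u)
    & forall u, c (h * u) = oph f (c u)].

Lemma coefficients_exist : exists c, coefficients c.
Proof.
have [rel univ] := hA.
have [[rho [hrho [rx ry rh]]] _] := univ _ _ _ _ (endo_Hrel q f g).
(* The family fed to [rho a] is that of the monomial [1], so the result is the family of [a * 1]. *)
exists (fun a => rho a (fun i k => ((i == 0) && (k == 0))%:R)).
split=> [a u v i k|i k|u|u|u].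
- by rewrite (alg_homD hrho) (alg_homZ hrho).
- by rewrite (alg_hom1 hrho).
- by rewrite (alg_homM hrho) rx.
- by rewrite (alg_homM hrho) ry.
- by rewrite (alg_homM hrho) rh.
Qed.

Context (c : A -> V) (hc : coefficients c).

Lemma coefD u v i k : c (u + v) i k = c u i k + c v i k.
Proof. by case: hc => lin _ _ _ _; rewrite -[u]scale1r lin !scale1r. Qed.
Lemma coef0 i k : c 0 i k = 0.
Proof. by apply: (addrI (c 0 i k)); rewrite -coefD !addr0. Qed.
Lemma coefZ a u i k : c (a *: u) i k = a *: c u i k.
Proof.
by case: hc => lin _ _ _ _; rewrite -[a *: u]addr0 lin coef0 addr0.
Qed.
Lemma coef_sum (I : Type) (r : seq I) (P : pred I) (G : I -> A) i k :
  c (\sum_(j <- r | P j) G j) i k = \sum_(j <- r | P j) c (G j) i k.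
Proof.
by apply: (big_morph (fun u => c u i k)) => [u v|]; rewrite ?coefD ?coef0.
Qed.
Lemma coef1 i k : c 1 i k = ((i == 0) && (k == 0))%:R.
Proof. by case: hc. Qed.
Lemma coef_xM u i k : c (x * u) i k = if i is i'.+1 then c u i' k else 0.
Proof. by case: hc => _ _ -> _ _. Qed.
Lemma coef_yM u i k : c (y * u) i k =
  (if k is k'.+1 then q ^+ i *: (c u i k' \Po f) else 0) + gsum q f g i.+1 * c u i.+1 k.
Proof. by case: hc => _ _ _ -> _. Qed.
Lemma coef_hM u i k : c (h * u) i k = fcomp i * c u i k.
Proof. by case: hc => _ _ _ _ ->. Qed.

Lemma coef_phM p u i k : c (peval p h * u) i k = (p \Po fcomp i) * c u i k.
Proof.
elim/poly_ind: p u => [|p b IHp] u.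
  by rewrite peval0 comp_poly0 !mul0r coef0.
rewrite pevalMXaddC comp_poly_MXaddC !mulrDl coefD mulr_algl coefZ mul_polyC.
by rewrite -mulrA IHp coef_hM mulrA.
Qed.

Lemma coef_xnM n u i k : c (x ^+ n * u) i k = if (n <= i)%N then c u (i - n) k else 0.
Proof.
elim: n i => [|n IHn] i; first by rewrite mul1r subn0.
by rewrite exprS -mulrA coef_xM; case: i => [|i] //; rewrite IHn ltnS subSS.
Qed.

Lemma coef_yn n i k : c (y ^+ n) i k = ((i == 0) && (k == n))%:R.
Proof.
elim: n i k => [|n IHn] i k; first by rewrite coef1.
rewrite exprS coef_yM !IHn /= mulr0 addr0.
case: k => [|k]; first by rewrite andbF.
rewrite IHn eqSS; case: i => [|i] /=; last by rewrite comp_poly0 scaler0.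
by rewrite scale1r; case: (k == n); rewrite ?comp_poly0 // rmorph1.
Qed.

Definition mono i p k : A := x ^+ i * peval p h * y ^+ k.

(** This is the linear independence of the monomials: [y ^+ k] sits in row 0, where [peval p h] acts
    as [p] because [fcomp 0] is ['X], and [x ^+ i] only shifts rows. *)
Lemma coef_mono i p k i' k' :
  c (mono i p k) i' k' = if (i' == i) && (k' == k) then p else 0.
Proof.
rewrite /mono -mulrA coef_xnM; case: leqP => [le_ii'|]; last first.
  by move=> lt; rewrite ltn_eqF.
rewrite coef_phM coef_yn subn_eq0.
have -> : (i' <= i)%N = (i' == i) by rewrite eqn_leq le_ii' andbT.
case: eqP => [->|] /=; last by rewrite mulr0.
rewrite subnn comp_polyXr.
by case: eqP; rewrite ?mulr1 ?mulr0.
Qed.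

(** * Straightening rules for products of generators *)

Lemma hM_xn n : h * x ^+ n = x ^+ n * peval (fcomp n) h.
Proof.
have [[hx yh yx] _] := hA.
elim: n => [|n IHn]; first by rewrite mul1r mulr1 pevalX.
rewrite exprSr mulrA IHn -!mulrA (peval_intertwine _ _ _ _ hx).
by rewrite -[in RHS]/(f \Po fcomp n) -peval_comp -fcompSr.
Qed.

Lemma phM_xn p n : peval p h * x ^+ n = x ^+ n * peval (p \Po fcomp n) h.
Proof. by rewrite peval_comp; apply: peval_intertwine; exact: hM_xn. Qed.

Lemma ynM_h n : y ^+ n * h = peval (fcomp n) h * y ^+ n.
Proof.
have [[hx yh yx] _] := hA.
elim: n => [|n IHn]; first by rewrite mul1r mulr1 pevalX.
rewrite exprS -mulrA IHn mulrA.
rewrite -(peval_intertwine (fcomp n) _ _ _ (esym yh)).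
by rewrite -mulrA -peval_comp fcompSr.
Qed.

Lemma ynM_ph p n : y ^+ n * peval p h = peval (p \Po fcomp n) h * y ^+ n.
Proof.
by rewrite peval_comp; apply/esym/peval_intertwine/esym/ynM_h.
Qed.

Lemma yM_xn n : y * x ^+ n =
  q ^+ n *: (x ^+ n * y) + (if n is m.+1 then x ^+ m * peval (gsum q f g n) h else 0).
Proof.
have [[hx yh yx] _] := hA.
elim: n => [|n IHn]; first by rewrite mul1r mulr1 scale1r addr0.
rewrite [x ^+ n.+1 in LHS]exprS mulrA.
have -> : y * x = q *: (x * y) + peval g h by rewrite -yx addrC subrK.
rewrite mulrDl -scalerAl -(mulrA x) IHn mulrDr scalerDr -scalerAr scalerA -exprS.
rewrite mulrA -exprS -addrA phM_xn; congr (_ + _).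
rewrite [gsum _ _ _ _]/= pevalD pevalZ mulrDr [RHS]addrC -scalerAr.
congr (_ + _); case: n {IHn} => [|n]; first by rewrite peval0 !mulr0 scaler0.
by rewrite mulrA -exprS.
Qed.

(** * Spanning by monomials *)

Inductive spanned : A -> Prop :=
| spanned0 : spanned 0
| spannedD i p k u of spanned u : spanned (mono i p k + u).

Lemma spanned_mono i p k : spanned (mono i p k).
Proof. by rewrite -[mono _ _ _]addr0; apply: spannedD; exact: spanned0. Qed.

Lemma spanned_add u v : spanned u -> spanned v -> spanned (u + v).
Proof.
move=> su sv; elim: su => [|i p k w _ IHw]; first by rewrite add0r.
by rewrite -addrA; exact: spannedD.
Qed.

Lemma spanned_image (T : A -> A) : (forall u v, T (u + v) = T u + T v) ->
  (forall i p k, spanned (T (mono i p k))) -> forall u, spanned u -> spanned (T u).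
Proof.
move=> TD Tm u; elim=> [|i p k w _ IHw]; last by rewrite TD; exact: spanned_add.
have -> : T 0 = 0 by apply: (addrI (T 0)); rewrite -TD !addr0.
exact: spanned0.
Qed.

Lemma spannedZ a u : spanned u -> spanned (a *: u).
Proof.
apply: (spanned_image ( *:%R a)) => [? ?|i p k]; first exact: scalerDr.
rewrite /mono scalerAl scalerAr -pevalZ; exact: spanned_mono.
Qed.

(** By induction on the generation of [a], it suffices to multiply a monomial on the left by [x],
    [y] or [h]; the straightening rules return at most two monomials. *)
Lemma spannedM a u : spanned u -> spanned (a * u).
Proof.
elim: (Hq_generated _ _ _ _ _ _ _ _ hA a) u => {a}.
- move=> a Sa u; apply: (spanned_image ( *%R a)) => [? ?|i p k].
    exact: mulrDr.
  move: Sa; rewrite !inE => /or3P[]/eqP->; rewrite /mono !mulrA.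
  + by rewrite -exprS; exact: spanned_mono.
  + rewrite yM_xn !mulrDl -!scalerAl; apply: spanned_add.
      apply: spannedZ.
      rewrite -(mulrA _ y) -[y]expr1 ynM_ph mulrA -!mulrA -exprD !mulrA.
      exact: spanned_mono.
    case: i => [|i]; first by rewrite !mul0r; exact: spanned0.
    by rewrite -(mulrA (x ^+ i)) -pevalM; exact: spanned_mono.
  + by rewrite hM_xn -(mulrA (x ^+ i)) -pevalM; exact: spanned_mono.
- by move=> u su; rewrite mul1r.
- move=> b u v _ IHu _ IHv w sw; rewrite mulrDl -scalerAl.
  by apply: spanned_add; [apply/spannedZ/IHu | apply: IHv].
- by move=> u v _ IHu _ IHv w sw; rewrite -mulrA; apply/IHu/IHv.
Qed.

Lemma mono_p0 i k : mono i 0 k = 0.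
Proof. by rewrite /mono peval0 mulr0 mul0r. Qed.

Lemma monoD i p r k : mono i (p + r) k = mono i p k + mono i r k.
Proof. by rewrite /mono pevalD mulrDr mulrDl. Qed.

(** All bounds above [N] are allowed, so that several elements can be expanded over one common
    square of indices. *)
Lemma coef_expansion a : exists N, forall M, (N <= M)%N ->
  a = \sum_(i < M) \sum_(k < M) mono i (c a i k) k.
Proof.
have: spanned a.
  rewrite -[a]mulr1; apply: spannedM.
  have <- : mono 0 1 0 = 1.
    by rewrite /mono -polyC1 pevalC scale1r !mulr1.
  exact: spanned_mono.
elim=> [|i p k u _ [N IH]].
  exists 0 => M _; apply/esym/big1 => i _; apply/big1 => k _.
  by rewrite coef0 mono_p0.
exists (maxn N (maxn i.+1 k.+1)) => M; rewrite !geq_max => /and3P[NM iM kM].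
under eq_bigr => i' _ do (under eq_bigr => k' _ do rewrite coefD monoD;
  rewrite big_split /=).
rewrite big_split /= -(IH _ NM); congr (_ + _).
rewrite (bigD1 (Ordinal iM)) //= (bigD1 (Ordinal kM)) //= coef_mono !eqxx /=.
rewrite big1 ?addr0 => [|k' /negPf nk]; last first.
  by rewrite coef_mono -(inj_eq val_inj) /= in nk *; rewrite nk andbF mono_p0.
rewrite big1 ?addr0 // => i' /negPf ni; rewrite big1 // => k' _.
by rewrite coef_mono -(inj_eq val_inj) /= in ni *; rewrite ni mono_p0.
Qed.

Lemma coef_inj a b : (forall i k, c a i k = c b i k) -> a = b.
Proof.
move=> ab; have [N Na] := coef_expansion a; have [M Mb] := coef_expansion b.
rewrite (Na (maxn N M)) ?leq_maxl // (Mb (maxn N M)) ?leq_maxr //.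
by apply: eq_bigr => i _; apply: eq_bigr => k _; rewrite ab.
Qed.

(** The map [c] is specified through left multiplication only, so [a] is expanded and [r] is moved
    across each power of [y]. *)
Lemma coefMh a r i k : c (a * peval r h) i k = c a i k * (r \Po fcomp k).
Proof.
have [N /(_ N (leqnn N)) aE] := coef_expansion a.
rewrite [in LHS]aE [in RHS]aE mulr_suml !coef_sum mulr_suml.
apply: eq_bigr => i' _; rewrite mulr_suml !coef_sum mulr_suml.
apply: eq_bigr => k' _.
rewrite {1}/mono -mulrA ynM_ph !mulrA -(mulrA (x ^+ i')) -pevalM.
rewrite -/(mono i' _ k') !coef_mono; case: eqP => //= _; last by rewrite mul0r.
by case: eqP => [->//|]; rewrite mul0r.
Qed.

(** * Leading positions and absence of zero divisors *)

Context (hq : q != 0) (hdeg : (1 < (size f).-1)%N).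
Local Notation d := (size f).-1.

Lemma size_f_gt1 : (1 < size f)%N. Proof. lia. Qed.

Lemma size_fcomp n : size (fcomp n) = (d ^ n).+1.
Proof.
have H : (size (fcomp n)).-1 = (d ^ n)%N.
  elim: n => [|n IHn]; first by rewrite size_polyX.
  by rewrite fcompSr size_comp_poly IHn expnSr.
have : (0 < d ^ n)%N by rewrite expn_gt0; lia.
by rewrite -H; case: size.
Qed.

Lemma size_fcomp_gt1 n : (1 < size (fcomp n))%N.
Proof. by rewrite size_fcomp ltnS expn_gt0; lia. Qed.

(* The leading position of [a] is taken in the lexicographic order, the
   exponent [K] of [y] coming before the exponent [I] of [x]. *)
Definition lead (a : A) (K I : nat) : Prop :=
  c a I K != 0 /\
  forall i k, (K < k)%N || (K == k) && (I < i)%N -> c a i k = 0.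

Lemma lead_neq0 a K I : lead a K I -> a != 0.
Proof. by move=> [+ _]; apply: contraNneq => ->; rewrite coef0. Qed.

Lemma lead_uniq a K I K' I' : lead a K I -> lead a K' I' -> K = K' /\ I = I'.
Proof.
move=> [nz up] [nz' up'].
have H : (K < K')%N || (K == K') && (I < I')%N = false.
  by apply: contraNF nz' => /up ->.
have H' : (K' < K)%N || (K' == K) && (I' < I)%N = false.
  by apply: contraNF nz => /up' ->.
lia.
Qed.

Lemma lead_phM p a K I : p != 0 -> lead a K I -> lead (peval p h * a) K I.
Proof.
move=> p0 [nz up]; split=> [|i k /up ck]; last by rewrite coef_phM ck mulr0.
by rewrite coef_phM mulf_neq0 // comp_poly_eq0 // size_fcomp_gt1.
Qed.

Lemma lead_xnM n a K I : lead a K I -> lead (x ^+ n * a) K (n + I).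
Proof.
move=> [nz up]; split=> [|i k Hik]; rewrite coef_xnM.
  by rewrite leq_addr addKn.
by case: leqP => // ni; apply: up; lia.
Qed.

(** The [gsum] term does not raise the exponent of [y], so it stays below [K.+1]; hence [y] is
    compared before [x]. The new leading coefficient survives because [q] is nonzero and [f] is not
    constant. *)
Lemma lead_yM a K I : lead a K I -> lead (y * a) K.+1 I.
Proof.
move=> [nz up]; split=> [|i k Hik]; rewrite coef_yM.
  rewrite (up I.+1 K.+1); last lia.
  by rewrite mulr0 addr0 scaler_eq0 expf_eq0 (negPf hq) andbF /=
             comp_poly_eq0 // size_f_gt1.
rewrite (up i.+1 k); last lia.
rewrite mulr0 addr0; case: k Hik => // k Hik.
by rewrite (up i k) ?comp_poly0 ?scaler0 //; lia.
Qed.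

Lemma lead_ynM n a K I : lead a K I -> lead (y ^+ n * a) (n + K) I.
Proof.
move=> la; elim: n => [|n IHn]; first by rewrite mul1r.
by rewrite exprS -mulrA; exact: lead_yM.
Qed.

Lemma lead_monoM i p k a K I : p != 0 -> lead a K I ->
  lead (mono i p k * a) (k + K) (i + I).
Proof.
by move=> p0 la; rewrite /mono -!mulrA; apply/lead_xnM/lead_phM/lead_ynM.
Qed.

Lemma lead_mul a b K I M L :
  lead a K I -> lead b M L -> lead (a * b) (K + M) (I + L).
Proof.
move=> [nz up] lb; have [N] := coef_expansion a.
move=> /(_ (maxn N (maxn K.+1 I.+1)) (leq_maxl _ _)).
set N' := maxn _ _ => aE.
have iN : (I < N')%N by lia.
have kN : (K < N')%N by lia.
(* From the expected leading position upwards, only the leading monomial of [a] contributes to the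
   product. *)
have mainE i k : (K + M < k)%N || (K + M == k)%N && (I + L <= i)%N ->
    c (a * b) i k = c (mono I (c a I K) K * b) i k.
  move=> Hik.
  have other (i' k' : nat) : ~~ ((i' == I) && (k' == K)) ->
      c (mono i' (c a i' k') k' * b) i k = 0.
    move=> ne; have [->|p0] := eqVneq (c a i' k') 0.
      by rewrite mono_p0 mul0r coef0.
    have [_ upm] := lead_monoM i' _ k' _ _ _ p0 lb.
    have : ~~ ((K < k')%N || (K == k') && (I < i')%N).
      by apply: contraNN p0 => /up ->.
    by move=> H; apply: upm; lia.
  rewrite {1}aE mulr_suml coef_sum (bigD1 (Ordinal iN)) //=.
  rewrite mulr_suml coef_sum (bigD1 (Ordinal kN)) //=.
  rewrite big1 ?addr0 => [|k' /negPf nk]; last first.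
    by apply: other; rewrite eqxx /= -[_ == K]/(k' == Ordinal kN) nk.
  rewrite big1 ?addr0 // => i' /negPf ni; rewrite mulr_suml coef_sum big1 //.
  by move=> k' _; apply: other; rewrite -[_ == I]/(i' == Ordinal iN) ni.
have [nzm upm] := lead_monoM I _ K _ _ _ nz lb.
split=> [|i k Hik]; first by rewrite mainE //; lia.
by rewrite mainE ?upm //; lia.
Qed.

(** The expansion makes the support finite: [K] is the largest exponent of [y] occurring in it, and
    [I] the largest exponent of [x] occurring together with [K]. *)
Lemma lead_exists a : a != 0 -> exists K I, lead a K I.
Proof.
move=> a0; have [N /(_ N (leqnn N)) aE] := coef_expansion a.
have out i k : (N <= i)%N || (N <= k)%N -> c a i k = 0.
  move=> Hik; rewrite aE coef_sum big1 // => i' _; rewrite coef_sum big1 // => k' _.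
  rewrite coef_mono ifF //; case: i' k' => [i' Hi'] [k' Hk'] /=; lia.
pose P k := [exists i : 'I_N, c a i k != 0].
have PP i k : c a i k != 0 -> P k.
  move=> nz; apply/existsP.
  have iN : (i < N)%N by rewrite ltnNge; apply: contraNN nz => iN; rewrite out ?iN.
  by exists (Ordinal iN).
have exP : exists k, P k.
  case: (pselect (exists k, P k)) => // nP; case/eqP: a0.
  apply: coef_inj => i k; rewrite coef0; apply/eqP.
  by case: eqP => // /eqP /PP Pk; case: nP; exists k.
have ubP k : P k -> (k <= N)%N.
  move=> /existsP[i nz]; rewrite leqNgt; apply: contraNN nz => Nk.
  by rewrite out // (ltnW Nk) orbT.
case: (ex_maxnP exP ubP) => K /existsP[i0 nz0] maxK.
have exQ : exists i, c a i K != 0 by exists i0.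
have ubQ i : c a i K != 0 -> (i <= N)%N.
  move=> nz; rewrite leqNgt; apply: contraNN nz => Ni.
  by rewrite out // (ltnW Ni).
case: (ex_maxnP exQ ubQ) => I nz maxI; exists K, I; split=> // i k.
move=> Hik; apply/eqP; apply/idPn => nzk.
have kK := maxK _ (PP _ _ nzk).
have ek : k = K by lia.
by rewrite ek in nzk; have := maxI i nzk; lia.
Qed.

Lemma Hq_mulf_neq0 (a b : A) : a != 0 -> b != 0 -> a * b != 0.
Proof.
move=> /lead_exists[K [I la]] /lead_exists[M [L lb]].
exact: lead_neq0 (lead_mul _ _ _ _ _ _ la lb).
Qed.

Lemma Hq_mulIf (a b u : A) : u != 0 -> a * u = b * u -> a = b.
Proof.
move=> u0 /eqP; rewrite -subr_eq0 -mulrBl => /eqP abu; apply/eqP.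
by rewrite -subr_eq0; apply: contraPT abu => ab; apply/eqP/Hq_mulf_neq0.
Qed.

Lemma Hq_mulfI (a b u : A) : u != 0 -> u * a = u * b -> a = b.
Proof.
move=> u0 /eqP; rewrite -subr_eq0 -mulrBr => /eqP abu; apply/eqP.
by rewrite -subr_eq0; apply: contraPT abu => ab; apply/eqP/Hq_mulf_neq0.
Qed.

Lemma coef_peval p i k : c (peval p h) i k = if (i == 0) && (k == 0) then p else 0.
Proof. by rewrite -(coef_mono 0 p 0) /mono mul1r mulr1. Qed.

Lemma peval_inj p r : peval p h = peval r h -> p = r.
Proof. by move=> /(congr1 (fun a => c a 0 0)); rewrite !coef_peval. Qed.

Lemma lead00 a : lead a 0 0 -> exists p, a = peval p h.
Proof.
move=> [_ up]; exists (c a 0 0); apply: coef_inj => i k; rewrite coef_peval.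
case: ifP => [/andP[/eqP-> /eqP->]//|H]; apply: up; lia.
Qed.

Lemma x_neq0 : x != 0.
Proof.
apply/eqP => x0; have := coef_xM 1 1 0; rewrite x0 mul0r coef0 coef1 => /eqP.
by rewrite eq_sym oner_eq0.
Qed.

Lemma y_neq0 : y != 0.
Proof.
apply/eqP => y0; have := coef_yn 1 0 1; rewrite expr1 y0 coef0 => /eqP.
by rewrite eq_sym oner_eq0.
Qed.

(** Each Horner step multiplies by [a] and adds a constant. Since [K] or [I] is positive, the
    constant lies strictly below the leading position of the product. *)
Lemma lead_peval a K I p : (0 < K)%N || (0 < I)%N -> lead a K I -> p != 0 ->
  lead (peval p a) ((size p).-1 * K) ((size p).-1 * I).
Proof.
move=> KI la; elim/poly_ind: p => [|p b IHp]; first by rewrite eqxx.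
rewrite size_MXaddC pevalMXaddC.
have [-> |p0 _] := eqVneq p 0.
  rewrite mul0r add0r polyC_eq0 peval0 mul0r add0r size_poly0 /= => b0.
  rewrite (negPf b0) mul0n -(pevalC b h); split=> [|i k Hik].
    by rewrite coef_peval polyC_eq0.
  by rewrite coef_peval ifF //; lia.
rewrite /=; have [nz up] := lead_mul _ _ _ _ _ _ (IHp p0) la.
have sp : (0 < size p)%N by rewrite size_poly_gt0.
have E (n : nat) : (size p * n = (size p).-1 * n + n)%N by nia.
rewrite !E {E}.
have low i k : (0 < k)%N || (0 < i)%N -> c (b%:A) i k = 0.
  by move=> Hik; rewrite coefZ coef1 [_ && _](_ : _ = false) ?scaler0 //; lia.
split=> [|i k Hik]; rewrite coefD low ?addr0 //; try lia.
by apply: up; lia.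
Qed.

(** * The shape of an automorphism *)

Implicit Types (s t : A -> A) (u v : A) (p r : {poly F}).

Lemma aut_inverse s : is_aut s ->
  exists2 t : A -> A, is_aut t & cancel s t /\ cancel t s.
Proof.
move=> [hs [t st ts]]; exists t => //; split; last by exists s.
have inj := can_inj st; split=> [a u v||u v]; apply: inj.
- by rewrite (alg_homD hs) (alg_homZ hs) !ts.
- by rewrite (alg_hom1 hs) ts.
- by rewrite (alg_homM hs) !ts.
Qed.

Lemma aut_neq0 s u : is_aut s -> u != 0 -> s u != 0.
Proof.
move=> [hs [t st _]]; apply: contraNneq => su.
by apply/eqP/(can_inj st); rewrite su (alg_hom0 hs).
Qed.

Lemma aut_h_peval s : is_aut s -> exists p, s h = peval p h.
Proof.
move=> auts; have [hs _] := auts; have [rel _] := hA.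
have [hx _ _] := alg_hom_Hrel hs _ _ _ _ _ _ rel.
have [->|/lead_exists[K [I lh]]] := eqVneq (s h) 0; first by exists 0; rewrite peval0.
have [M [L lx]] := lead_exists _ (aut_neq0 _ _ auts x_neq0).
have [KI|] := boolP ((0 < K)%N || (0 < I)%N); last first.
  rewrite negb_or -!eqn0Ngt => /andP[/eqP K0 /eqP I0].
  by apply: lead00; rewrite K0 I0 in lh.
have f0 : f != 0 by rewrite -size_poly_gt0; lia.
have l1 := lead_mul _ _ _ _ _ _ lh lx.
have := lead_mul _ _ _ _ _ _ lx (lead_peval _ _ _ _ KI lh f0).
(* Additivity gives [K = d * K] and [I = d * I]; as [d > 1], both vanish, contrary to [KI]. *)
rewrite -hx => /(lead_uniq _ _ _ _ _ l1); nia.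
Qed.

Lemma aut_h s : is_aut s -> exists2 p, s h = peval p h & size p = 2.
Proof.
move=> auts; have [t autt [st ts]] := aut_inverse _ auts.
have [p sp] := aut_h_peval _ auts; have [r tr] := aut_h_peval _ autt.
exists p => //; have [hs _] := auts.
(* Evaluated at [h], the composite is [s (t h) = h]; hence the degrees of [r] and [p] multiply to
   1. *)
have : r \Po p = 'X.
  by apply: peval_inj; rewrite peval_comp pevalX -sp -(alg_hom_peval hs) -tr ts.
move=> /(congr1 (fun u : {poly F} => (size u).-1)).
rewrite size_comp_poly size_polyX /= => /eqP; rewrite muln_eq1 => /andP[_ /eqP].
by case: size => // n /= ->.
Qed.

(** Comparing degrees gives [d ^ i = d ^ k.+1], and [d > 1]. *)
Lemma comp_weight p i k : size p = 2 ->
  p \Po fcomp i = (f \Po p) \Po fcomp k -> i = k.+1.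
Proof.
move=> sp /(congr1 (fun u : {poly F} => (size u).-1)).
rewrite !size_comp_poly sp !size_fcomp mul1n muln1 -expnS => /eqP.
by rewrite eqn_exp2l // => /eqP.
Qed.

(** At position [(i, k)] the two sides of the image of [h * x = x * peval f h] multiply the same
    coefficient by these two composites; a nonzero coefficient cancels in [{poly F}]. *)
Lemma aut_coef_x s p : is_aut s -> s h = peval p h ->
  forall i k, c (s x) i k != 0 -> p \Po fcomp i = (f \Po p) \Po fcomp k.
Proof.
move=> [hs _] sp i k nz; have [rel _] := hA.
have [hx _ _] := alg_hom_Hrel hs _ _ _ _ _ _ rel.
move: hx; rewrite sp -peval_comp => /(congr1 (fun u => c u i k)).
by rewrite coef_phM coefMh mulrC => /(mulfI nz).
Qed.

Lemma aut_coef_y s p : is_aut s -> s h = peval p h ->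
  forall i k, c (s y) i k != 0 -> p \Po fcomp k = (f \Po p) \Po fcomp i.
Proof.
move=> [hs _] sp i k nz; have [rel _] := hA.
have [_ yh _] := alg_hom_Hrel hs _ _ _ _ _ _ rel.
move: yh; rewrite sp -peval_comp => /(congr1 (fun u => c u i k)).
by rewrite coef_phM coefMh [RHS]mulrC => /(mulfI nz).
Qed.

Lemma expansion_ind (Q : A -> Prop) a : Q 0 ->
  (forall u v, Q u -> Q v -> Q (u + v)) ->
  (forall i k, c a i k != 0 -> Q (mono i (c a i k) k)) -> Q a.
Proof.
move=> Q0 QD Qm; have [N /(_ N (leqnn N)) ->] := coef_expansion a.
apply: big_ind => // i _; apply: big_ind => // k _.
by have [->|/Qm //] := eqVneq (c a i k) 0; rewrite mono_p0.
Qed.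

Lemma aut_x_factor s : is_aut s -> exists z, s x = x * z.
Proof.
move=> auts; have [p sp size_p] := aut_h _ auts.
apply: (expansion_ind (fun u => exists z, u = x * z)) => [|u v [z ->] [w ->]|i k nz].
- by exists 0; rewrite mulr0.
- by exists (z + w); rewrite mulrDr.
- rewrite (comp_weight _ _ _ size_p (aut_coef_x _ _ auts sp _ _ nz)).
  by rewrite /mono exprS -!mulrA; eexists.
Qed.

Lemma aut_y_factor s : is_aut s -> exists w, s y = w * y.
Proof.
move=> auts; have [p sp size_p] := aut_h _ auts.
apply: (expansion_ind (fun u => exists w, u = w * y)) => [|u v [z ->] [w ->]|i k nz].
- by exists 0; rewrite mul0r.
- by exists (z + w); rewrite mulrDl.
- rewrite (comp_weight _ _ _ size_p (aut_coef_y _ _ auts sp _ _ nz)).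
  by rewrite /mono exprSr mulrA; eexists.
Qed.

(** Degrees add up to zero, so both factors are polynomials in [h], and polynomials with product 1
    are constant. *)
Lemma Hq_unit_const u v : u * v = 1 -> (exists a, u = a%:A) /\ (exists b, v = b%:A).
Proof.
move=> uv; have u0 : u != 0.
  by apply: contra_eqN uv => /eqP->; rewrite mul0r eq_sym oner_eq0.
have v0 : v != 0.
  by apply: contra_eqN uv => /eqP->; rewrite mulr0 eq_sym oner_eq0.
have [K [I lu]] := lead_exists _ u0; have [M [L lv]] := lead_exists _ v0.
have l1 : lead 1 0 0.
  split=> [|i k Hik]; rewrite coef1 ?oner_eq0 //.
  by rewrite [_ && _](_ : _ = false) //; lia.
have := lead_mul _ _ _ _ _ _ lu lv; rewrite uv => /(lead_uniq _ _ _ _ _ l1) [e1 e2].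
have [p up] : exists p, u = peval p h.
  by apply: lead00; move: lu; have [-> ->] : K = 0%N /\ I = 0%N by lia.
have [r vr] : exists r, v = peval r h.
  by apply: lead00; move: lv; have [-> ->] : M = 0%N /\ L = 0%N by lia.
have pr : p * r = 1.
  by apply: peval_inj; rewrite pevalM -up -vr uv -polyC1 pevalC scale1r.
have := size_mul_eq1 p r; rewrite pr size_poly1 eqxx.
move=> /esym/andP[/size_poly1P[a _ pa]] /size_poly1P[b _ rb].
split; [exists a | exists b].
  by rewrite up pa pevalC.
by rewrite vr rb pevalC.
Qed.

(** With [t] the inverse and [t x = x * w], applying [s] gives [x = x * z * s w]; cancelling [x]
    shows that [z] is a unit, hence a scalar. *)
Lemma aut_x s : is_aut s -> exists2 l, l != 0 & s x = l *: x.
Proof.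
move=> auts; have [t autt [st ts]] := aut_inverse _ auts; have [hs _] := auts.
have [z sz] := aut_x_factor _ auts; have [w tw] := aut_x_factor _ autt.
have : x * (z * s w) = x * 1 by rewrite mulrA -sz -(alg_homM hs) -tw ts mulr1.
move=> /(Hq_mulfI _ _ _ x_neq0) /Hq_unit_const[[l zl] _].
have sl : s x = l *: x by rewrite sz zl mulr_algr.
exists l => //; apply: contraNneq (aut_neq0 _ _ auts x_neq0) => l0.
by rewrite sl l0 scale0r.
Qed.

Lemma aut_y s : is_aut s -> exists2 m, m != 0 & s y = m *: y.
Proof.
move=> auts; have [t autt [st ts]] := aut_inverse _ auts; have [hs _] := auts.
have [z sz] := aut_y_factor _ auts; have [w tw] := aut_y_factor _ autt.
have : (s w * z) * y = 1 * y by rewrite -mulrA -sz -(alg_homM hs) -tw ts mul1r.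
move=> /(Hq_mulIf _ _ _ y_neq0) /Hq_unit_const[_ [m zm]].
have sm : s y = m *: y by rewrite sz zm mulr_algl.
exists m => //; apply: contraNneq (aut_neq0 _ _ auts y_neq0) => m0.
by rewrite sm m0 scale0r.
Qed.

Lemma aut_shape s : is_aut s -> exists l m p,
  [/\ l != 0, m != 0 & size p = 2] /\
  [/\ s x = l *: x, s y = m *: y & s h = peval p h] /\
  p \Po f = f \Po p /\ (l * m) *: g = g \Po p.
Proof.
move=> auts; have [l l0 sx] := aut_x _ auts; have [m m0 sy] := aut_y _ auts.
have [p sp size_p] := aut_h _ auts; exists l, m, p; do 3!split=> //.
  (* Position [(1, 0)] of [s x] carries [l], which is nonzero; there [fcomp 1] is [f] and [fcomp 0]
     is ['X]. *)
  have := aut_coef_x _ _ auts sp 1 0; rewrite sx coefZ -[x]mulr1 coef_xM coef1.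
  rewrite alg_polyC polyC_eq0 => /(_ l0).
  by rewrite -[fcomp 1]/(f \Po 'X) !comp_polyXr.
have [hs _] := auts; have [rel _] := hA.
have [_ _] := alg_hom_Hrel hs _ _ _ _ _ _ rel; have [_ _ yx] := rel.
(* Under [s], the left side of the third relation is scaled by [l * m], while [g] becomes
   [g \Po p]. *)
rewrite sx sy sp -peval_comp -!scalerAr -!scalerAl !scalerA => yx'.
apply: peval_inj; rewrite -yx' pevalZ -yx scalerBr !scalerA.
by rewrite -[in RHS]mulrA [m * l]mulrC [q * _]mulrC.
Qed.

Lemma hom_ext (s t : A -> A) : alg_hom s -> alg_hom t ->
  s x = t x -> s y = t y -> s h = t h -> s =1 t.
Proof.
move=> hs ht; have [rel univ] := hA.
by have [_ uniq] := univ _ _ _ _ rel; exact: uniq.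
Qed.
End Coefficients.

(** * Affine polynomials commuting with f *)

Section AffineCommuting.
Context {F : fieldType} {f : {poly F}}.
Context (hdeg : (1 < (size f).-1)%N).

Implicit Types p r : {poly F}.

(** If [a] and [b] are the leading coefficients of [p] and [f], and [d] is the degree of [f], those
    of the two composites are [a * b] and [b * a ^+ d]. *)
Lemma affine_commuting_lead p : size p = 2 -> p \Po f = f \Po p ->
  lead_coef p ^+ ((size f).-1 - 1) = 1.
Proof.
move=> sp /(congr1 lead_coef); have f1 : (1 < size f)%N by lia.
have p0 : lead_coef p != 0 by rewrite lead_coef_eq0 -size_poly_gt0 sp.
have f0 : lead_coef f != 0 by rewrite lead_coef_eq0 -size_poly_gt0; lia.
rewrite !lead_coef_comp ?sp //= expr1 mulrC => /(mulfI f0).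
rewrite -[in RHS](@subnK 1 (size f).-1); last lia.
by rewrite addn1 exprSr -{1}[lead_coef p]mul1r => /(mulIf p0).
Qed.

Context (hchar : forall p : nat, p \in [pchar F] -> ((size f).-1 < p)%N).

(* [f - 'X] is invariant under the translation by [b], hence takes the same
   value at the [deg f + 1] points [b *+ n]. *)
Lemma translation_commuting b : f \Po ('X + b%:P) = f + b%:P -> b = 0.
Proof.
move=> fb; apply/eqP/idPn => b0.
pose u := f - 'X.
have ub z : u.[z + b] = u.[z].
  have := congr1 (fun r : {poly F} => r.[z]) fb.
  rewrite horner_comp !hornerE => fbz.
  by rewrite fbz opprD addrACA addrN addr0.
have un n : u.[b *+ n] = u.[0].
  by elim: n => [|n IHn]; rewrite ?mulr0n // mulrSr ub IHn.
have su : size (u - u.[0]%:P) = size f.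
  rewrite /u -addrA size_polyDl // (leq_ltn_trans (size_polyD _ _)) //.
  rewrite gtn_max !size_polyN size_polyX; apply/andP; split; first lia.
  by rewrite (leq_ltn_trans (size_polyC_leq1 _)) //; lia.
have u0 : u - u.[0]%:P != 0 by rewrite -size_poly_gt0 su; lia.
pose rs := [seq b *+ n | n <- iota 0 (size f)].
have rootrs : all (root (u - u.[0]%:P)) rs.
  by apply/allP => _ /mapP[n _ ->]; rewrite /root hornerD hornerN hornerC un subrr.
suff /(max_poly_roots u0 rootrs) : uniq rs by rewrite size_map size_iota su ltnn.
rewrite map_inj_in_uniq ?iota_uniq // => m n.
(* If [b *+ k] vanished, the characteristic would be a prime dividing [k], which is at most the
   degree of [f]. *)
have inj k : (0 < k)%N -> (k < size f)%N -> b *+ k != 0.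
  move=> k0 kf; rewrite -mulr_natr mulf_neq0 //; apply/negP => kz.
  have [p pc] := natf0_pchar k0 kz.
  have := hchar _ pc; rewrite -(dvdn_pcharf pc) in kz.
  by have := dvdn_leq k0 kz; lia.
rewrite !mem_iota !add0n /= => mf nf e; apply/eqP; rewrite eqn_leq.
apply/andP; split; rewrite leqNgt; apply/negP => lt.
  have /negP[] : b *+ (m - n) != 0.
    by apply: inj; [rewrite subn_gt0 | exact: leq_ltn_trans (leq_subr _ _) mf].
  by rewrite mulrnBr ?(ltnW lt) // e subrr.
have /negP[] : b *+ (n - m) != 0.
  by apply: inj; [rewrite subn_gt0 | exact: leq_ltn_trans (leq_subr _ _) nf].
by rewrite mulrnBr ?(ltnW lt) // e subrr.
Qed.

(** The two polynomials differ by a constant [b]. Composing the relation for [r] with the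
    compositional inverse [w] of [p] yields the translation identity, so [b = 0]. *)
Lemma affine_commuting_uniq p r : size p = 2 -> size r = 2 ->
  p \Po f = f \Po p -> r \Po f = f \Po r -> lead_coef p = lead_coef r -> p = r.
Proof.
move=> sp sr pf rf pr.
have affine (u : {poly F}) : size u = 2 -> u = lead_coef u *: 'X + (u`_0)%:P.
  move=> su; apply/polyP => -[|[|i]]; rewrite !coefE /= lead_coefE su /=.
  - by rewrite mulr0 add0r.
  - by rewrite mulr1 addr0.
  - by rewrite mulr0 addr0 nth_default ?su.
have a0 : lead_coef p != 0 by rewrite lead_coef_eq0 -size_poly_gt0 sp.
set a := lead_coef p in pr a0; pose b := r`_0 - p`_0.
pose w := a^-1 *: ('X - (p`_0)%:P).
have pE := affine p sp; have rE := affine r sr; rewrite -pr -/a in rE.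
have pw : p \Po w = 'X.
  rewrite pE comp_polyD comp_polyZ comp_polyX comp_polyC /w scalerA mulfV //.
  by rewrite scale1r subrK.
have rp : r = p + b%:P by rewrite rE {1}pE -addrA -polyCD [p`_0 + b]addrC subrK.
have b0 : b = 0.
  apply: translation_commuting.
  have := congr1 (fun u => u \Po w) rf.
  rewrite rp -!comp_polyA !comp_polyD !comp_polyC pw => <-.
  by rewrite comp_polyA pf -comp_polyA pw comp_polyXr.
by rewrite rp b0 addr0.
Qed.
End AffineCommuting.

(* Multiplication by an element permutes [S], so comparing the products of all
   elements gives [a ^+ #|S| = 1]: the elements of [S] are all the roots of
   unity of order [#|S|]. *)
Lemma finite_unity_group_cyclic (F : fieldType) (m : nat) (S : F -> Prop) :
  (0 < m)%N -> S 1 -> (forall a b, S a -> S b -> S (a * b)) ->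
  (forall a, S a -> a ^+ m = 1) ->
  exists n z, [/\ n.-primitive_root z, (n %| m)%N, S z
    & forall a, S a -> exists2 i, (i < n)%N & a = z ^+ i].
Proof.
move=> m0 S1 SM Sm.
(* Elements of [S] are [m]-th roots of unity, so duplicate-free lists in [S] have length at most
   [m], and one of maximal length exhausts [S]. *)
pose P n := `[< exists rs : seq F,
  [/\ uniq rs, size rs = n & forall a, a \in rs -> S a] >].
have exP : exists n, P n by exists 0; apply/asboolP; exists [::].
have ubP n : P n -> (n <= m)%N.
  move=> /asboolP[rs [urs <- Srs]]; apply: max_unity_roots => //.
  by apply/allP => a /Srs /Sm /eqP; rewrite unity_rootE.
case: (ex_maxnP exP ubP) => n /asboolP[rs [urs srs Srs]] maxn.
have rsP a : S a -> a \in rs.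
  move=> Sa; apply/idPn => nars.
  suff /maxn : P n.+1 by rewrite ltnn.
  apply/asboolP; exists (a :: rs); split=> /=; rewrite ?nars ?srs //.
  by move=> b; rewrite inE => /predU1P[->|/Srs].
have rs0 a : a \in rs -> a != 0.
  move=> /Srs /Sm; apply: contra_eq_neq => ->.
  by rewrite expr0n eqn0Ngt m0 eq_sym oner_eq0.
have n0 : (0 < n)%N by rewrite -srs; have := rsP _ S1; case: (rs).
have rsn a : a \in rs -> a ^+ n = 1.
  move=> ars; have Pars : perm_eq rs [seq a * b | b <- rs].
    rewrite perm_sym; apply: uniq_perm => //.
      by rewrite map_inj_uniq //; exact/mulfI/rs0.
    have uM : uniq [seq a * b | b <- rs].
      by rewrite map_inj_uniq //; exact/mulfI/rs0.
    apply: (uniq_min_size uM _ _).2; last by rewrite size_map.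
    by move=> _ /mapP[b brs ->]; apply: rsP; apply: SM; exact: Srs.
  have : \prod_(b <- rs) b = \prod_(b <- [seq a * b | b <- rs]) b.
    exact: perm_big.
  rewrite /= big_map big_split /= big_const_seq count_predT srs iter_mulr_1.
  rewrite -[X in X = _]mul1r => /esym /mulIf -> //.
  by rewrite big_seq prodf_seq_neq0; apply/allP => b brs; rewrite brs rs0.
have /hasP[z zrs prim_z] : has n.-primitive_root rs.
  apply: has_prim_root => //; last by rewrite srs.
  by apply/allP => a /rsn /eqP; rewrite unity_rootE.
exists n, z; split=> //; last 1 first.
- move=> a Sa; have [i ->] := prim_rootP prim_z (rsn _ (rsP _ Sa)).
  by exists i.
- by rewrite (prim_order_dvd prim_z) Sm //; exact: Srs.
- exact: Srs.
Qed.

(** * The automorphism group *)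

Section Automorphisms.
Context {F : fieldType} {q : F} {f g : {poly F}} {A : algType F} {x y h : A}.
Context (hA : is_Hq q f g x y h) (hq : q != 0) (hdeg : (1 < (size f).-1)%N).
Implicit Types (s t k : A -> A) (l m : F) (p r : {poly F}).

Let gens_ext s t : alg_hom s -> alg_hom t ->
  s x = t x -> s y = t y -> s h = t h -> s =1 t.
Proof. exact: hom_ext hA s t. Qed.

Let shape s : is_aut s -> exists l m p,
  [/\ l != 0, m != 0 & size p = 2] /\
  [/\ s x = l *: x, s y = m *: y & s h = peval p h] /\
  p \Po f = f \Po p /\ (l * m) *: g = g \Po p.
Proof. by have [c hc] := coefficients_exist hA; exact: aut_shape hA c hc hq hdeg s. Qed.

Let pevalI p r : peval p h = peval r h -> p = r.
Proof. by have [c hc] := coefficients_exist hA; exact: peval_inj c hc p r. Qed.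

Lemma scale_x_inj l m : l *: x = m *: x -> l = m.
Proof.
have [c hc] := coefficients_exist hA => /eqP; rewrite -subr_eq0 -scalerBl.
by rewrite scaler_eq0 subr_eq0 (negPf (x_neq0 c hc)) orbF => /eqP.
Qed.

Lemma is_aut_id : is_aut (@id A).
Proof. by split; [exact: alg_hom_id | exists id]. Qed.

Lemma is_aut_comp s t : is_aut s -> is_aut t -> is_aut (s \o t).
Proof. by move=> [hs bs] [ht bt]; split; [exact: alg_hom_comp | exact: bij_comp]. Qed.

Lemma phi_mul l m s t : is_phi x y h l s -> is_phi x y h m t ->
  is_phi x y h (l * m) (s \o t).
Proof.
move=> [l0 auts [sx sy sh]] [m0 autt [tx ty th]]; have [hs _] := auts.
split; [by rewrite mulf_neq0 | exact: is_aut_comp | split=> /=].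
- by rewrite tx (alg_homZ hs) sx scalerA mulrC.
- by rewrite ty (alg_homZ hs) sy scalerA invfM mulrC.
- by rewrite th sh.
Qed.

Lemma phi_ext l s t : is_phi x y h l s -> is_phi x y h l t -> s =1 t.
Proof.
move=> [_ [hs _] [sx sy sh]] [_ [ht _] [tx ty th]].
by apply: gens_ext; rewrite ?tx ?ty ?th.
Qed.

Lemma phi_id : is_phi x y h 1 id.
Proof. by split; [exact: oner_neq0 | exact: is_aut_id | rewrite invr1 !scale1r]. Qed.

(** The triple [l *: x], [l^-1 *: y], [h] satisfies the relations; the endomorphism obtained from
    [l^-1] is the inverse. *)
Lemma phi_exists l : l != 0 -> exists s, is_phi x y h l s.
Proof.
have [rel univ] := hA; have [hx yh yx] := rel.
have homs m : m != 0 ->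
    exists s, alg_hom s /\ [/\ s x = m *: x, s y = m^-1 *: y & s h = h].
  move=> m0; apply: (univ A _ _ _ _).1; split.
  - by rewrite -scalerAr hx scalerAl.
  - by rewrite -scalerAl yh scalerAr.
  - by rewrite -!scalerAl -!scalerAr !scalerA mulVf // mulfK // scale1r.
move=> l0; have [s [hs [sx sy sh]]] := homs _ l0.
have li0 : l^-1 != 0 by rewrite invr_eq0.
have [t [ht [tx ty th]]] := homs _ li0.
exists s; split=> //; split=> //; exists t => u.
  apply: (gens_ext (t \o s) id (alg_hom_comp _ _ _ _ _ _ ht hs) (alg_hom_id _ _)) => /=.
  - by rewrite sx (alg_homZ ht) tx scalerA mulfV // scale1r.
  - by rewrite sy (alg_homZ ht) ty scalerA mulfV // scale1r.
  - by rewrite sh.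
apply: (gens_ext (s \o t) id (alg_hom_comp _ _ _ _ _ _ hs ht) (alg_hom_id _ _)) => /=.
- by rewrite tx (alg_homZ hs) sx scalerA mulVf // scale1r.
- by rewrite ty (alg_homZ hs) sy scalerA mulVf // scale1r.
- by rewrite th.
Qed.

(** Every automorphism scales [x] and [y] and sends [h] to a polynomial in [h], which [s] fixes. *)
Lemma phi_central l s t : is_phi x y h l s -> is_aut t -> s \o t =1 t \o s.
Proof.
move=> [l0 [hs _] [sx sy sh]] autt; have [ht _] := autt.
have [m [n [p [_ [[tx ty th] _]]]]] := shape _ autt.
apply: gens_ext; try exact: alg_hom_comp; rewrite /=.
- by rewrite tx sx (alg_homZ hs) (alg_homZ ht) tx sx !scalerA mulrC.
- by rewrite ty sy (alg_homZ hs) (alg_homZ ht) ty sy !scalerA mulrC.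
- by rewrite th sh (alg_hom_peval hs) sh.
Qed.

Lemma aut_decomposition s : is_aut s -> exists l (p k : A -> A),
  [/\ is_phi x y h l p, fixes_x x k & s =1 p \o k].
Proof.
move=> auts; have [l [m [r [[l0 _ _] [[sx _ _] _]]]]] := shape _ auts.
have [p hp] := phi_exists _ l0.
have li0 : l^-1 != 0 by rewrite invr_eq0.
have [p' hp'] := phi_exists _ li0; have [_ autp' [p'x _ _]] := hp'.
(* Here [p'] is the scaling by [l^-1], which restores [x] after [s]. *)
exists l, p, (p' \o s); split=> //.
  split; first exact: is_aut_comp.
  by rewrite /= sx (alg_homZ autp'.1) p'x scalerA mulfV // scale1r.
move=> u /=; have := phi_mul _ _ _ _ hp hp'; rewrite mulfV // => pp'.
by rewrite -[RHS]/((p \o p') (s u)) (phi_ext _ _ _ pp' phi_id).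
Qed.

Lemma decomposition_uniq l1 l2 (p1 p2 k1 k2 : A -> A) :
  is_phi x y h l1 p1 -> is_phi x y h l2 p2 ->
  fixes_x x k1 -> fixes_x x k2 -> p1 \o k1 =1 p2 \o k2 -> l1 = l2 /\ k1 =1 k2.
Proof.
move=> hp1 hp2 [_ k1x] [_ k2x] e.
have [_ _ [p1x _ _]] := hp1; have [_ [_ /bij_inj p2I] [p2x _ _]] := hp2.
have l12 : l1 = l2.
  by have /= := e x; rewrite k1x k2x p1x p2x => /scale_x_inj.
split=> // u; apply: p2I; rewrite -[RHS]/((p2 \o k2) u) -e /=.
by rewrite l12 in hp1; exact: phi_ext hp2 hp1 (k1 u).
Qed.

(** The slope is multiplicative under composition and turns automorphisms into roots of unity. It is
    a relation because [p] is only known to exist. *)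
Definition h_slope s (a : F) : Prop :=
  exists p, [/\ size p = 2, lead_coef p = a & s h = peval p h].

Lemma h_slope_id : h_slope id 1.
Proof. by exists 'X; rewrite size_polyX lead_coefX pevalX. Qed.

Lemma h_slope_comp s t a b :
  alg_hom s -> h_slope s a -> h_slope t b -> h_slope (s \o t) (a * b).
Proof.
move=> hs [p [sp <- sh]] [r [sr <- th]]; exists (r \Po p); split.
- by rewrite size_comp_poly2.
- by rewrite lead_coef_comp ?sp // sr expr1 mulrC.
- by rewrite /= th (alg_hom_peval hs) sh peval_comp.
Qed.

Lemma h_slope_inj s t a b : h_slope s a -> h_slope t b -> s =1 t -> a = b.
Proof.
move=> [p [_ <- sh]] [r [_ <- th]] st.
by congr lead_coef; apply: pevalI; rewrite -sh -th st.
Qed.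

Lemma h_slope_exists s : is_aut s -> exists a, h_slope s a.
Proof.
move=> /shape[l [m [p [[_ _ sp] [[_ _ sh] _]]]]].
by exists (lead_coef p), p.
Qed.

Lemma h_slope_unity s a : is_aut s -> h_slope s a -> a ^+ ((size f).-1 - 1) = 1.
Proof.
move=> /shape[l [m [p [_ [[_ _ sh] [pf _]]]]]] [r [sr <- sh']].
have pr : p = r by apply: pevalI; rewrite -sh -sh'.
by apply: (affine_commuting_lead hdeg r sr); rewrite -pr.
Qed.

Lemma fixes_x_id : fixes_x x id. Proof. by split; first exact: is_aut_id. Qed.

Lemma fixes_x_comp s t : fixes_x x s -> fixes_x x t -> fixes_x x (s \o t).
Proof. by move=> [auts sx] [autt tx]; split; [exact: is_aut_comp | rewrite /= tx]. Qed.

Context (hg : g != 0).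
Context (hchar : forall p : nat, p \in [pchar F] -> ((size f).-1 < p)%N).

(** The slope determines [p]. As [x] is fixed, the scalar [m] on [y] satisfies [m *: g = g \Po p],
    which determines [m] because [g] is nonzero. *)
Lemma fixes_x_ext s t a :
  fixes_x x s -> fixes_x x t -> h_slope s a -> h_slope t a -> s =1 t.
Proof.
move=> [auts sx] [autt tx] [ps [_ las hs]] [pt [_ lat ht]].
have [l [m [p [[_ _ sp] [[sx' sy sh] [pf gp]]]]]] := shape _ auts.
have [l' [m' [r [[_ _ sr] [[tx' ty th] [rf gr]]]]]] := shape _ autt.
have l1 : l = 1 by apply: scale_x_inj; rewrite -sx' sx scale1r.
have l'1 : l' = 1 by apply: scale_x_inj; rewrite -tx' tx scale1r.
have pr : p = r.
  apply: (affine_commuting_uniq hdeg hchar) => //.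
  have -> : p = ps by apply: pevalI; rewrite -sh -hs.
  have -> : r = pt by apply: pevalI; rewrite -th -ht.
  by rewrite las lat.
apply: gens_ext; rewrite ?sx ?tx ?sh ?th ?pr //; try by case: auts; case: autt.
rewrite sy ty; congr (_ *: _); apply/eqP; rewrite -subr_eq0.
have : m *: g == m' *: g.
  by move: gp gr; rewrite l1 l'1 !mul1r pr => -> ->.
by rewrite -subr_eq0 -scalerBl scaler_eq0 (negPf hg) orbF.
Qed.

(** The slopes form a finite cyclic group of roots of unity. An automorphism [k] over a generator
    [z] generates, since the slope is faithful on automorphisms fixing [x]. *)
Lemma fixes_x_cyclic : exists n k,
  [/\ (n %| (size f).-1 - 1)%N, fixes_x x k, iter n k =1 id,
      (forall s, fixes_x x s -> exists2 i : nat, (i < n)%N & s =1 iter i k)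
    & (forall i j : nat, (i < n)%N -> (j < n)%N -> iter i k =1 iter j k -> i = j)].
Proof.
pose S a := exists s, fixes_x x s /\ h_slope s a.
have [||a b|a|n [z [prim_z nd [k [fk kz]] zP]]] :=
  finite_unity_group_cyclic F ((size f).-1 - 1) S.
- lia.
- by exists id; split; [exact: fixes_x_id | exact: h_slope_id].
- move=> [s [fs sa]] [t [ft tb]]; exists (s \o t); split; first exact: fixes_x_comp.
  by apply: h_slope_comp => //; case: fs => -[].
- by move=> [s [[auts _] sa]]; exact: h_slope_unity auts sa.
have iterP i : fixes_x x (iter i k) /\ h_slope (iter i k) (z ^+ i).
  elim: i => [|i [fi iz]]; first by split; [exact: fixes_x_id | exact: h_slope_id].
  split; first exact: fixes_x_comp fk fi.
  by rewrite exprS; apply: (h_slope_comp k (iter i k)) => //; case: fk => -[].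
exists n, k; split=> //.
- have [fn] := iterP n; rewrite (prim_expr_order prim_z) => n1.
  exact: fixes_x_ext fn fixes_x_id n1 h_slope_id.
- move=> s fs; have [a sa] := h_slope_exists _ fs.1.
  have [|i lt_in az] := zP a; first by exists s.
  have [fi iz] := iterP i; exists i => //.
  by apply: (fixes_x_ext _ _ a) => //; rewrite az.
- move=> i j lt_in lt_jn eij.
  have /eqP := h_slope_inj _ _ _ _ (iterP i).2 (iterP j).2 eij.
  by rewrite (eq_prim_root_expr prim_z) !modn_small // => /eqP.
Qed.

(** On [x] and [y] only scalars intervene. On [h] the two composites of [p] and [r] both commute
    with [f] and share their leading coefficient, so they coincide. *)
Lemma aut_abelian s t : is_aut s -> is_aut t -> s \o t =1 t \o s.
Proof.
move=> auts autt; have [hs _] := auts; have [ht _] := autt.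
have [l [m [p [[_ _ sp] [[sx sy sh] [pf _]]]]]] := shape _ auts.
have [l' [m' [r [[_ _ sr] [[tx ty th] [rf _]]]]]] := shape _ autt.
apply: gens_ext; try exact: alg_hom_comp; rewrite /=.
- by rewrite tx sx (alg_homZ hs) (alg_homZ ht) tx sx !scalerA mulrC.
- by rewrite ty sy (alg_homZ hs) (alg_homZ ht) ty sy !scalerA mulrC.
rewrite sh th (alg_hom_peval hs) (alg_hom_peval ht) sh th -!peval_comp.
congr (peval _ _); apply: (affine_commuting_uniq hdeg hchar).
- by rewrite size_comp_poly2.
- by rewrite size_comp_poly2.
- by rewrite -comp_polyA pf comp_polyA rf comp_polyA.
- by rewrite -comp_polyA rf comp_polyA pf comp_polyA.
- by rewrite !lead_coef_comp ?sp ?sr // !expr1 mulrC.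
Qed.
End Automorphisms.

Theorem theorem5p2 (F : fieldType) (q : F) (f g : {poly F})
  (hq : q != 0) (hdeg : (1 < (size f).-1)%N) (hg : g != 0)
  (A : algType F) (x y h : A) (hA : is_Hq q f g x y h) :
  ( (* phi_lambda exists for every lambda in F^* *)
      (forall l : F, l != 0 -> exists s, is_phi x y h l s) /\
      (* lambda |-> phi_lambda is a group homomorphism F^* -> Aut(A) ... *)
      (forall l m (s t : A -> A), is_phi x y h l s -> is_phi x y h m t ->
         is_phi x y h (l * m) (s \o t)) /\
      (* ... which is injective, so {phi_lambda} is isomorphic to F^* *)
      (forall l m (s t : A -> A), is_phi x y h l s -> is_phi x y h m t ->
         s =1 t -> l = m) /\
      (* {phi_lambda} is central in Aut(A) *)
      (forall l (s t : A -> A), is_phi x y h l s -> is_aut t ->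
         s \o t =1 t \o s) /\
      (* internal direct product: every automorphism is phi_lambda o kappa ... *)
      (forall s : A -> A, is_aut s -> exists l (p k : A -> A),
         [/\ is_phi x y h l p, fixes_x x k & s =1 p \o k]) /\
      (* ... uniquely *)
      (forall l1 l2 (p1 p2 k1 k2 : A -> A),
         is_phi x y h l1 p1 -> is_phi x y h l2 p2 ->
         fixes_x x k1 -> fixes_x x k2 -> p1 \o k1 =1 p2 \o k2 ->
         l1 = l2 /\ k1 =1 k2) /\
      (* if char F = 0 or char F > deg f *)
      ((forall p : nat, p \in [pchar F] -> ((size f).-1 < p)%N) ->
       (* {phi : phi(x) = x} is finite cyclic of order n dividing deg f - 1 *)
       (exists (n : nat) (k0 : A -> A),
          [/\ (n %| (size f).-1 - 1)%N, fixes_x x k0, iter n k0 =1 id,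
              (forall k : A -> A, fixes_x x k ->
                 exists2 i : nat, (i < n)%N & k =1 iter i k0)
            & (forall i j : nat, (i < n)%N -> (j < n)%N ->
                 iter i k0 =1 iter j k0 -> i = j)])
       /\ (* hence Aut(A) is abelian *)
       (forall s t : A -> A, is_aut s -> is_aut t -> s \o t =1 t \o s))).
Proof.
split; first exact: phi_exists hA.
split; first exact: phi_mul.
split.
  move=> l m s t [_ _ [sx _ _]] [_ _ [tx _ _]] st.
  by apply: (scale_x_inj hA); rewrite -sx -tx st.
split; first exact: phi_central hA hq hdeg.
split; first exact: aut_decomposition hA hq hdeg.
split; first exact: decomposition_uniq hA.
move=> hchar; split; first exact: fixes_x_cyclic hA hq hdeg hg hchar.
exact: aut_abelian hA hq hdeg hchar.
Qed.
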